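(* Let $1\le m\le n$ and let $K(m,n)$ be the number of reduced $m\times n$ Latin rectangles. With the notation of the context, $$K(m,n)=\sum_{R}\ \sum_{C}\ (-1)^{nm+\sum W}\ \frac{\prod_{l=0}^{m}\prod_{Z}q(Z)!}{\prod_{\alpha\in A_m} r_\alpha!\ \prod_{\beta\in A_m}c_\beta!} =(-1)^{n(m-1)}\sum_{R}\ \sum_{C}\ \frac{\prod_{l=0}^{m}\prod_{Z}\langle -q(Z)\rangle_{q(Z)}}{\prod_{\alpha\in A_m} r_\alpha!\ \prod_{\beta\in A_m}c_\beta!},$$ where: the sum over $R$ is over all families $(r_\alpha)_{\alpha\in A_m}$ of nonnegative integers with $\sum_\alpha r_\alpha=n$; the sum over $C$ is over all families $(c_\beta)_{\beta\in A_m}$ of nonnegative integers satisfying, for every $l\in[m]$ and every $l$-component $Z$, the constraint $\sum_{\beta: Z_l(\beta)=Z}c_\beta=q(Z)$; for each $l\in[m]$ the inner product $\prod_Z$ runs over all $l$-components $Z$, while for $l=0$ it consists of the single factor with $q=n$; and $\sum W=\sum_{\alpha:\ \zeta(\alpha)\text{ odd}}r_\alpha$.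
   Context: A reduced $m\times n$ Latin rectangle is an $m\times n$ array with entries in $[n]=\{1,\dots,n\}$, with no entry repeated in any row or column, whose first row is $1\,2\,\dots\,n$. Let $A_m$ be the set of integer tuples $\alpha=(\alpha_m,\dots,\alpha_1)$ with $0\le\alpha_j\le j-1$ for all $j$ (so $|A_m|=m!$). Covering and components: for $\alpha\in A_m$ and a position $i$ with $\alpha_i>0$, let $\kappa(i)=\alpha_i<i$; positions with $\alpha_i=0$ have no image, and iterating $\kappa$ from any position reaches a position $h$ with $\alpha_h=0$. For each $h$ with $\alpha_h=0$, the component $Z_h(\alpha)$ is the set of positions $j$ with $\kappa^k(j)=h$ for some $k\ge0$, together with their values $\alpha_j$; if $\alpha_h\neq0$ then $\alpha$ has no component at $h$. An $l$-component is any object of the form $Z_l(\alpha)$ for some $\alpha\in A_m$. $\zeta(\alpha)$ is the number of $j$ with $\alpha_j=0$ (the number of components of $\alpha$). Given nonnegative integers $r_\alpha$ ($\alpha\in A_m$), for an $l$-component $Z$ put $q(Z)=\sum_{\alpha:\ Z_l(\alpha)=Z}r_\alpha$. $\langle x\rangle_k=x(x+1)\cdots(x+k-1)$ denotes the rising factorial (so $\langle -q\rangle_q=(-1)^q q!$). *)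

(* Defs.v *)
From HB Require Import structures.
From mathcomp Require Import all_boot all_order all_algebra.
Set Implicit Arguments.
Unset Strict Implicit.
Unset Printing Implicit Defensive.
Import GRing.Theory.

Definition reduced_latin m n (L : 'M['I_n]_(m, n)) : bool :=
  [&& [forall i, injectiveb (fun j => L i j)],
      [forall j, injectiveb (fun i => L i j)]
    & [forall i : 'I_m, forall j, (i == 0 :> nat) ==> (L i j == j)]].

Definition K m n : nat := #|[set L : 'M['I_n]_(m, n) | reduced_latin L]|.

(* The ordinal j : 'I_m stands for the position j + 1, so that the bound
   0 <= alpha_(j+1) <= j reads alpha j : 'I_j.+1. The values are not shifted:
   a value v > 0 refers to the position v, i.e., to the ordinal v - 1. *)
Definition A m := {dffun forall j : 'I_m, 'I_j.+1}.

Definition root_at m (a : A m) (h : 'I_m) : bool := a h == 0 :> nat.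

(* insub never fails here, as a j - 1 < j < m when a j > 0. *)
Definition kappa m (a : A m) (j : 'I_m) : option 'I_m :=
  if root_at a j then None else insub (a j).-1.

Definition reaches m (a : A m) (j h : 'I_m) : bool :=
  connect [rel x y | kappa a x == Some y] j h.

(* A component is the set of its pairs (position, value); the value, at most
   m - 1, is stored in 'I_m. *)
Definition component m (h : 'I_m) (a : A m) : option {set 'I_m * 'I_m} :=
  if root_at a h
  then Some [set p : 'I_m * 'I_m | reaches a p.1 h && (p.2 == a p.1 :> nat)]
  else None.

Definition components m (l : 'I_m) : {set {set 'I_m * 'I_m}} :=
  [set Z | [exists a : A m, component l a == Some Z]].

Definition zeta m (a : A m) : nat := #|[set j | root_at a j]|.

Definition q m (r : A m -> nat) (l : 'I_m) (Z : {set 'I_m * 'I_m}) : nat :=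
  \sum_(a | component l a == Some Z) r a.

Definition admR m n (r : A m -> nat) : bool := \sum_a r a == n.

Definition admC m (r c : A m -> nat) : bool :=
  [forall l : 'I_m, forall Z in components l, q c l Z == q r l Z].

Definition sumW m (r : A m -> nat) : nat := \sum_(a | odd (zeta a)) r a.

(* The next two lemmas show that nothing is lost by summing over families with
   values in {0, ..., n} instead of nat. *)
Lemma admR_bound m n (r : A m -> nat) : admR n r -> forall a, r a <= n.
Proof. by move=> /eqP <- a; rewrite (bigD1 a) //= leq_addr. Qed.

Lemma admC_bound m n (r c : A m -> nat) :
  0 < m -> admR n r -> admC r c -> forall b, c b <= n.
Proof.
case: m r c => // m r c _ /eqP sum_r /forallP/(_ ord0)/'forall_implyP eq_q.
have root0 (a : A m.+1) : root_at a ord0.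
  by rewrite /root_at; case: (a ord0) => -[].
have sum_q (f : A m.+1 -> nat) :
    \sum_a f a = \sum_(Z in components (@ord0 m)) q f ord0 Z.
  pose Z0 a := odflt set0 (component (@ord0 m) a).
  have Z0E a : component ord0 a = Some (Z0 a).
    by rewrite /Z0 /component root0.
  rewrite (partition_big Z0 (mem (components ord0))) /=; last first.
    by move=> a _; rewrite inE; apply/existsP; exists a; rewrite Z0E.
  by apply: eq_bigr => Z _; apply: eq_bigl => a; rewrite Z0E.
apply: admR_bound; rewrite /admR -sum_r !sum_q; apply/eqP/eq_bigr => Z ZZ.
by apply/eqP/eq_q.
Qed.

Definition families m n := {ffun A m -> 'I_n.+1}.

Local Open Scope ring_scope.

Definition rising (S : nzRingType) (x : S) (k : nat) : S :=
  \prod_(i < k) (x + i%:R).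

Definition denom m n (r c : families m n) : rat :=
  ((\prod_a (r a)`! * \prod_b (c b)`!)%N)%:R.

(* In both sums the factor for l = 0 is written separately; the remaining
   product over l : 'I_m runs over the positions l + 1 = 1, ..., m. *)
Definition factorial_sum (m n : nat) : rat :=
  \sum_(r : families m n | admR n (fun a => r a))
    \sum_(c : families m n | admC (fun a => r a) (fun b => c b))
      (-1) ^+ (n * m + sumW (fun a => r a))
      * ((n`! * \prod_(l < m) \prod_(Z in components l)
                  (q (fun a => r a) l Z)`!)%N%:R
         / denom r c).

Definition rising_sum (m n : nat) : rat :=
  \sum_(r : families m n | admR n (fun a => r a))
    \sum_(c : families m n | admC (fun a => r a) (fun b => c b))
      rising (- n%:R) n
      * (\prod_(l < m) \prod_(Z in components l)
           rising (- (q (fun a => r a) l Z)%:R) (q (fun a => r a) l Z))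
      / denom r c.

(* Main.v *)
(* The entries x_1, ..., x_m of a column are distinct iff the product over i of
   [1 - #{k < i | x_k = x_i}] is 1 rather than 0. Expanding it gives the sum over
   alpha in A_m of (-1)^(m - zeta(alpha)) times the indicator that x is constant
   along kappa. Hence n! K(m,n), the number of all m x n Latin rectangles, is a
   signed count of pairs of a word a of n elements of A_m, one per column, and
   an m-tuple of permutations whose column j is constant on each component of
   a_j. Each symbol s then inherits an element b_s of A_m: its value at row i is
   that of a_j, for j the column where s stands in row i. Given a and b, the
   permutations amount to bijections, for each l and each l-component Z, from
   the columns j with Z_l(a_j) = Z to the symbols s with Z_l(b_s) = Z, which
   explains both the constraint on C and the factor q(Z)!. Finally there are
   n!/prod r_alpha! words a with multiplicities r, and likewise for b. *)

Require Import Defs.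
From mathcomp Require Import all_boot all_order all_algebra all_fingroup.
From mathcomp Require Import ring.

Set Implicit Arguments.
Unset Strict Implicit.
Unset Printing Implicit Defensive.

Import GRing.Theory.

Local Open Scope ring_scope.

(** * Expansion of the distinctness indicator *)

(** Reduces to the non-dependent distributivity over the disjoint union of the [T i]: choices whose
    value at [i] has tag [i] form an [fprod], in bijection with the dependent functions. *)
Lemma bigA_distr_dffun (R : pzSemiRingType) (I : finType) (T : I -> finType)
    (g : forall i, T i -> R) :
  \prod_i \sum_(v : T i) g i v
    = \sum_(a : {dffun forall i, T i}) \prod_i g i (a i).
Proof.
pose G i : {ffun T i -> R} := finfun (g i).
transitivity (\prod_i \sum_(v : T i) G i v).
  by apply: eq_bigr => i _; apply: eq_bigr => v _; rewrite ffunE.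
under eq_bigr => i _ do rewrite (big_tag (fun i => G i)).
rewrite bigA_distr_big_dep -big_fprod.
rewrite (reindex (@fprod_of_dffun I T)) /=; last first.
  exact/onW_bij/fprod_of_dffun_bij.
by apply: eq_bigr => a _; apply: eq_bigr => i _; rewrite ffunE fprodE.
Qed.

Lemma prod_nat_of_bool (R : pzSemiRingType) (I : finType) (b : pred I) :
  \prod_i (b i)%:R = [forall i, b i]%:R :> R.
Proof.
have [bT | /forallPn[i bF]] := boolP [forall i, b i].
  by rewrite big1 // => i _; rewrite (forallP bT).
by rewrite -natr_prod (bigD1 i) //= (negPf bF) mul0n.
Qed.

Lemma kappaP m (a : A m) (i k : 'I_m) :
  reflect (a i = k.+1 :> nat) (kappa a i == Some k).
Proof.
rewrite /kappa /root_at.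
apply: (iffP idP) => [|ai_k]; last first.
  by rewrite ai_k /= valK.
case: ifP => // /negbT; rewrite -lt0n => a_gt0.
by case: insubP => // u _ /= eq_u /eqP[<-]; rewrite eq_u prednK.
Qed.

Lemma kappa_root m (a : A m) i : (kappa a i == None) = root_at a i.
Proof.
rewrite /kappa; case: ifP => // /negbT ai; rewrite /root_at in ai.
have lt_am : ((a i).-1 < m)%N.
  by rewrite prednK ?lt0n // ltnW // (leq_trans (ltn_ord (a i))) // ltn_ord.
by rewrite insubT.
Qed.

Lemma kappa_lt m (a : A m) i k : kappa a i = Some k -> (k < i)%N.
Proof. by move/eqP/kappaP => ai; rewrite -ltnS -ai. Qed.

Definition fits_at m (T : eqType) (a : A m) (x : 'I_m -> T) (i : 'I_m) : bool :=
  if kappa a i is Some k then x i == x k else true.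

(** Equivalently, [x] is constant on each component of [a]. *)
Definition fits m (T : eqType) (a : A m) (x : 'I_m -> T) : bool :=
  [forall i, fits_at a x i].

(** If [x] is not injective, the least [i] that repeats an earlier entry repeats exactly one, as two
    equal earlier entries would be a smaller repetition; its factor is 1 - 1 = 0. *)
Lemma prod_one_minus_collisions (R : comNzRingType) m (T : eqType)
    (x : 'I_m -> T) :
  \prod_(i < m) (1 - \sum_(k < m | (k < i)%N) (x i == x k)%:R)
    = (injectiveb x)%:R :> R.
Proof.
have [x_inj | x_ninj] := boolP (injectiveb x).
  rewrite big1 // => i _; rewrite big1 ?subr0 // => k lt_ki.
  by rewrite (inj_eq (injectiveP _ x_inj)); case: eqP lt_ki => // ->; rewrite ltnn.
pose P (i : 'I_m) := [exists k : 'I_m, (k < i)%N && (x i == x k)].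
have [i0 Pi0] : exists i, P i.
  have [i [k ne_ik x_ik]] := injectivePn _ x_ninj.
  case: (ltngtP i k) => [lt_ik | lt_ki | eq_ik].
  - by exists k; apply/existsP; exists i; rewrite lt_ik x_ik /=.
  - by exists i; apply/existsP; exists k; rewrite lt_ki x_ik /=.
  - by rewrite (val_inj eq_ik) eqxx in ne_ik.
have [i /existsP[k /andP[lt_ki x_ik]] min_i] := arg_minnP val Pi0.
rewrite (bigD1 i) //= (bigD1 k) //= x_ik big1 ?addr0 ?subrr ?mul0r // => j.
case/andP=> lt_ji ne_jk; case: eqP => // x_ij.
have x_jk : x j == x k by rewrite -x_ij.
case: (ltngtP j k) => [lt_jk | lt_kj | eq_jk].
- suff /min_i : P k by rewrite leqNgt lt_ki.
  by apply/existsP; exists j; rewrite lt_jk eq_sym.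
- suff /min_i : P j by rewrite leqNgt lt_ji.
  by apply/existsP; exists k; rewrite lt_kj.
- by rewrite (val_inj eq_jk) eqxx in ne_jk.
Qed.

Lemma sum_nonroots m (a : A m) : (\sum_i ~~ root_at a i + zeta a = m)%N.
Proof.
have -> : zeta a = (\sum_i root_at a i)%N.
  by rewrite /zeta -sum1dep_card big_mkcond.
rewrite -big_split -[RHS]card_ord -sum1_card; apply: eq_bigr => i _ /=.
by case: (root_at a i).
Qed.

(* Expand the product of [1 - #{k < i | x k = x i}] over i: choosing the term
   1 or one of the k < i in each factor amounts to choosing an element of A m. *)
Lemma injectiveb_expand (R : comNzRingType) m (T : eqType) (x : 'I_m -> T) :
  (injectiveb x)%:R
    = \sum_(a : A m) (-1) ^+ (m + odd (zeta a)) * (fits a x)%:R :> R.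
Proof.
(* A copy of [kappa] depending on a single value, as distributivity needs; [par i (a i)] is
   convertible to [kappa a i]. *)
pose par (i : 'I_m) (v : 'I_i.+1) : option 'I_m :=
  if v == 0%N :> nat then None else insub v.-1.
pose g (i : 'I_m) (v : 'I_i.+1) : R :=
  if par i v is Some k then - (x i == x k)%:R else 1.
rewrite -prod_one_minus_collisions.
transitivity (\prod_i \sum_v g i v).
  (* The value 0 yields the term 1, and the value [k + 1] yields minus the indicator of
     [x i = x k]. *)
  apply: eq_bigr => i _; rewrite big_ord_recl /= {1}/g /=; congr (_ + _).
  rewrite -sumrN (big_ord_narrow (ltnW (ltn_ord i))); apply: eq_bigr => k _.
  rewrite /g /par /=; case: insubP => [u _ eq_uk | ].
    by congr (- (_ == x _)%:R); apply: val_inj.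
  by rewrite add0n (ltn_trans (ltn_ord k)).
rewrite bigA_distr_dffun; apply: eq_bigr => a _.
transitivity (\prod_i ((-1) ^+ (~~ root_at a i) * (fits_at a x i)%:R : R)).
  apply: eq_bigr => i _; rewrite -kappa_root /fits_at /g -[par i _]/(kappa a i).
  by case: (kappa a i) => [k|]; rewrite ?mulN1r ?mulr1.
rewrite big_split /= prodrXr. rewrite prod_nat_of_bool; congr (_ * _).
rewrite exprD signr_odd.
have /(congr1 (fun k => (-1 : R) ^+ k)) <- := sum_nonroots a.
by rewrite exprD -mulrA -exprD addnn -signr_odd odd_double mulr1.
Qed.

(** * Counting matchings and words *)

(** Induction on [s]: once the tail is matched, the head may take any element of its colour not yet
    used, which is the last factor of a falling factorial. *)
Lemma card_matching_tuples (X : Type) (Y C : finType) (f : X -> C) (g : Y -> C)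
    (s : seq X) k :
  size s = k ->
  #|[set t : k.-tuple Y | uniq t & map g t == map f s]|
    = (\prod_c #|[pred y | g y == c]| ^_ (count [pred x | f x == c] s))%N.
Proof.
elim: s k => [|x s IHs] [|k] //=.
  move=> _; rewrite (@eq_card1 _ [tuple]) => [|t]; last by rewrite [t]tuple0 !inE.
  by rewrite big1.
case=> sz_s; rewrite -sum1dep_card.
rewrite (reindex (fun p : k.-tuple Y * Y => [tuple of p.2 :: p.1])) /=; last first.
  exists (fun t : k.+1.-tuple Y => ([tuple of behead t], thead t)) => [[t y]|t] _.
    by rewrite /= theadE; congr pair; apply: val_inj.
  by rewrite /= -tuple_eta.
transitivity (\sum_(t : k.-tuple Y | uniq t && (map g t == map f s))
   \sum_(y | (y \notin t) && (g y == f x)) 1)%N.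
  rewrite pair_big_dep /=; apply: eq_bigl => -[t y] /=.
  by rewrite eqseq_cons -!andbA; do !bool_congr.
have step (t : k.-tuple Y) : uniq t && (map g t == map f s) ->
    (\sum_(y | (y \notin t) && (g y == f x)) 1
      = #|[pred y | g y == f x]| - count [pred z | f z == f x] s)%N.
  case/andP=> t_uniq /eqP gt; rewrite sum1dep_card cardsE.
  rewrite -(cardID (mem t) [pred y | g y == f x]).
  have -> : #|[predI [pred y | g y == f x] & mem t]|
              = count [pred z | f z == f x] s.
    rewrite -(count_map f (pred1 (f x))) -gt count_map -size_filter.
    have /card_uniqP <- := filter_uniq (preim g (pred1 (f x))) t_uniq.
    by apply: eq_card => y; rewrite !inE mem_filter.
  by rewrite addKn; apply: eq_card => y; rewrite !inE.
rewrite (eq_bigr _ step) sum_nat_const -cardsE (IHs _ sz_s).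
rewrite (bigD1 (f x)) //= [RHS](bigD1 (f x)) //= eqxx add1n ffactnSr.
rewrite mulnAC; congr (_ * _)%N; apply: eq_bigr => c ne_cx.
by rewrite eq_sym (negPf ne_cx) add0n.
Qed.

Lemma card_matchings (X Y C : finType) (f : X -> C) (g : Y -> C) :
  #|[set t : {ffun X -> Y} | injectiveb t & [forall x, g (t x) == f x]]|
    = (\prod_c #|[pred y | g y == c]| ^_ #|[pred x | f x == c]|)%N.
Proof.
transitivity (\prod_c #|[pred y | g y == c]|
                 ^_ (count [pred x | f x == c] (enum X)))%N; last first.
  apply: eq_bigr => c _; congr (_ ^_ _).
  by rewrite enumT [RHS]cardE /enum_mem size_filter; apply: eq_count.
rewrite -(card_matching_tuples _ _ (esym (cardE X))).
have bijFF: {on (_ : pred _), bijective (@Finfun X Y)}.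
  by exists fgraph => x _; [apply: FinfunK | apply: fgraphK].
rewrite -(on_card_preimset (bijFF _)); apply: eq_card => /= t.
rewrite !inE -[t in RHS]FinfunK -codom_ffun; congr (_ && _).
rewrite codomE -map_comp; apply/forallP/eqP => [gt | /eq_in_map gt x].
  by apply: eq_map => x /=; apply/eqP.
by apply/eqP/gt; rewrite mem_enum.
Qed.

(** The codomain makes the multiplicities of a word over [A m] a member of [families m n]; [inord]
    never truncates, as the word has [n] letters. *)
Definition counts (n : nat) (T : finType) (a : {ffun 'I_n -> T}) : {ffun T -> 'I_n.+1} :=
  [ffun x => inord #|[pred j | a j == x]|].

Lemma countsE n (T : finType) (a : {ffun 'I_n -> T}) x :
  counts a x = #|[pred j | a j == x]| :> nat.
Proof. by rewrite ffunE inordK // ltnS (leq_trans (max_card _)) ?card_ord. Qed.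

Lemma sum_counts n (T : finType) (a : {ffun 'I_n -> T}) (P : pred T) :
  (\sum_(x | P x) counts a x = \sum_j P (a j))%N.
Proof.
rewrite -[RHS]big_mkcond (partition_big a P) //=; apply: eq_bigr => x Px.
rewrite countsE -sum1_card; apply: eq_bigl => j; rewrite inE.
by case: eqP => [->|]; rewrite ?Px ?andbF.
Qed.

(* Double count the bijections from 'I_n to the disjoint union of the blocks
   'I_(r x): their tags are the words with counts r. *)
Lemma card_counts n (T : finType) (r : {ffun T -> 'I_n.+1}) :
  (\sum_x r x = n)%N ->
  (#|[set a | counts a == r]| * \prod_x (r x)`! = n`!)%N.
Proof.
move=> sum_r; pose Y := {x : T & 'I_(r x)}.
have card_tag x : #|[pred y : Y | tag y == x]| = r x.
  pose tg := @existT T (fun x => 'I_(r x)) x.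
  have tg_inj : injective tg by move=> j k /eqP; rewrite eq_Tagged => /eqP.
  rewrite -[RHS]card_ord -(card_codom tg_inj); apply: eq_card => y.
  rewrite !inE; apply/eqP/codomP => [|[j -> //]].
  by case: y => z j /= eq_zx; move: j; rewrite eq_zx => j; exists j.
have cardY : #|{: Y}| = n.
  by rewrite card_tagged sumnE big_map big_enum -[RHS]sum_r;
     apply: eq_bigr => x _; rewrite card_ord.
transitivity #|[set t : {ffun 'I_n -> Y} | injectiveb t]|; last first.
  by rewrite card_inj_ffuns cardY card_ord ffactnn.
pose tg (t : {ffun 'I_n -> Y}) : {ffun 'I_n -> T} := [ffun j => tag (t j)].
have fibre (a : {ffun 'I_n -> T}) :
    #|[set t : {ffun 'I_n -> Y} | injectiveb t & tg t == a]|
      = (\prod_x (r x) ^_ (counts a x))%N.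
  transitivity #|[set t : {ffun 'I_n -> Y} |
                   injectiveb t & [forall j, tag (t j) == a j]]|.
    apply: eq_card => t; rewrite !inE; congr (_ && _).
    apply/eqP/forallP => [<- j | e]; first by rewrite ffunE.
    by apply/ffunP => j; rewrite ffunE; apply/eqP.
  rewrite card_matchings; apply: eq_bigr => x _.
  by rewrite card_tag countsE.
rewrite -[RHS]sum1dep_card (partition_big tg (fun a => counts a == r)) /=.
  rewrite -sum1dep_card big_distrl /=; apply: eq_bigr => a /eqP counts_a.
  rewrite sum1dep_card fibre counts_a mul1n.
  by apply: eq_bigr => x _; rewrite ffactnn.
(* [Y] has [n] elements, so the injection [t] is a bijection and its tags have counts [r]. *)
move=> t t_inj; apply/eqP/ffunP => x; apply: val_inj; rewrite /= countsE.
rewrite -[RHS]card_tag -!sum1_card [RHS](reindex t) /=.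
  by apply: eq_bigl => j; rewrite !inE ffunE.
by apply/onW_bij/inj_card_bij; [apply/injectiveP | rewrite cardY card_ord].
Qed.

Lemma sum_over_counts (R : comNzRingType) (n : nat) (T : finType)
    (F : {ffun T -> 'I_n.+1} -> R) :
  \sum_(a : {ffun 'I_n -> T}) F (counts a)
    = \sum_(r : {ffun T -> 'I_n.+1} | (\sum_x r x == n)%N)
        #|[set a : {ffun 'I_n -> T} | counts a == r]|%:R * F r.
Proof.
rewrite (partition_big (@counts n T)
           (fun r : {ffun T -> 'I_n.+1} => \sum_x r x == n)%N) /=.
  apply: eq_bigr => r _; rewrite -sum1dep_card natr_sum big_distrl /=.
  by apply: eq_bigr => a /eqP ->; rewrite mul1r.
by move=> a _; rewrite (sum_counts a xpredT) sum1_card card_ord.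
Qed.

(** * Components and the permutations compatible with a pair of words *)

Section Roots.
Variable m : nat.
Implicit Types (a b : A m) (i h k : 'I_m).

Lemma ord_lt_ind (P : 'I_m -> Prop) :
  (forall i, (forall k, (k < i)%N -> P k) -> P i) -> forall i, P i.
Proof.
move=> ind i; have [N] := ubnP (val i).
elim: N i => // N IHN i lt_iN; apply: ind => k lt_ki.
exact/IHN/(leq_trans lt_ki).
Qed.

Lemma kappa_eq a b i : a i = b i -> kappa a i = kappa b i.
Proof. by rewrite /kappa /root_at => ->. Qed.

Lemma reaches_step a i h :
  reaches a i h = (i == h) || (if kappa a i is Some k then reaches a k h else false).
Proof.
apply/idP/orP => [/connectP[[|k p] /=] | [/eqP -> | ]].
- by move=> _ ->; left.
- by case/andP=> /eqP -> ? ?; right; apply/connectP; exists p.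
- exact: connect0.
case ki: (kappa a i) => [k|] //; apply: connect_trans.
by apply: connect1; rewrite /= ki.
Qed.

(** The default is never taken: [kappa] decreases positions, so its iteration stops at a root. *)
Definition root_of a i : 'I_m :=
  odflt i [pick h | root_at a h && reaches a i h].

Lemma root_ofP a i : root_at a (root_of a i) && reaches a i (root_of a i).
Proof.
rewrite /root_of; case: pickP => // no_root; case/negP: (negbT (no_root i)).
suff: exists h, root_at a h && reaches a i h by case=> h; rewrite no_root.
move: i {no_root}; apply: ord_lt_ind => i IHi.
case ki: (kappa a i) => [k|].
  have [h /andP[h_root kh]] := IHi k (kappa_lt ki).
  by exists h; rewrite h_root reaches_step ki kh orbT.
by exists i; rewrite -kappa_root ki reaches_step eqxx.
Qed.

Lemma root_of_root a i : root_at a (root_of a i).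
Proof. by case/andP: (root_ofP a i). Qed.

(** The root reached is unique, because [kappa] is a partial function undefined at roots. *)
Lemma reaches_root a i h : root_at a h -> reaches a i h = (root_of a i == h).
Proof.
move=> h_root; apply/idP/eqP => [ih | <-]; last by case/andP: (root_ofP a i).
have /andP[] := root_ofP a i; move: (root_of a i) => h'.
elim/ord_lt_ind: i ih => i IHi; rewrite (reaches_step a i h) (reaches_step a i h').
have root_None k : root_at a k -> kappa a k = None.
  by rewrite -kappa_root => /eqP.
case ki: (kappa a i) => [k|]; last by rewrite !orbF => /eqP <- _ /eqP.
have not_root k' : root_at a k' -> i == k' = false.
  by move=> /root_None rk; apply: contra_eqF ki => /eqP ->; rewrite rk.
move=> ih h'_root; move: ih; rewrite !not_root //= => kh kh'.
exact: (IHi k (kappa_lt ki)).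
Qed.

Lemma root_of_id a i : root_at a i -> root_of a i = i.
Proof. by move=> i_root; apply/eqP; rewrite -reaches_root // reaches_step eqxx. Qed.

Lemma root_of_kappa a i k : kappa a i = Some k -> root_of a i = root_of a k.
Proof.
move=> ki; apply/eqP; rewrite -reaches_root ?root_of_root // reaches_step ki.
by rewrite orbC reaches_root ?root_of_root // eqxx.
Qed.

Lemma isSome_component a h : isSome (component h a) = root_at a h.
Proof. by rewrite /component; case: ifP. Qed.

Lemma component_mem a h :
  root_at a h ->
  component h a
    = Some [set p : 'I_m * 'I_m | (root_of a p.1 == h) && (p.2 == a p.1 :> nat)].
Proof.
move=> h_root; rewrite /component h_root; congr Some; apply/setP => p.
by rewrite !inE reaches_root.
Qed.

Lemma component_agree a b h i :
  component h a = component h b -> root_of a i = h ->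
  root_of b i = h /\ b i = a i.
Proof.
move=> eq_ab rai; have a_root : root_at a h by rewrite -rai root_of_root.
have b_root : root_at b h by rewrite -isSome_component -eq_ab isSome_component.
have lt_am : (a i < m)%N := leq_trans (ltn_ord (a i)) (ltn_ord i).
move: eq_ab; rewrite !component_mem // => -[/setP/(_ (i, Ordinal lt_am))].
rewrite !inE /= rai !eqxx => /esym/andP[/eqP rbi /eqP ab]; split=> //.
exact: val_inj.
Qed.

End Roots.

(** * Pairs of words and rows given by permutations *)

Section Compatible.
Variables m n : nat.
Implicit Types (a b : {ffun 'I_n -> A m}) (sigma : {ffun 'I_m -> 'S_n}).

(** [sigma i] is row [i], sending columns to symbols; [a] is indexed by columns and [b] by
    symbols. *)
Definition compatible a b sigma : bool :=
  [forall j, fits (a j) (fun i => sigma i j)]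
    && [forall j, forall i, b (sigma i j) i == a j i].

Lemma compatible_fits a b sigma i j k :
  compatible a b sigma -> kappa (a j) i = Some k -> sigma i j = sigma k j.
Proof.
by case/andP=> /forallP/(_ j)/forallP/(_ i) + _; rewrite /fits_at => + ki;
   rewrite ki => /eqP.
Qed.

Lemma compatible_value a b sigma i j :
  compatible a b sigma -> b (sigma i j) i = a j i.
Proof. by case/andP=> _ /forallP/(_ j)/forallP/(_ i)/eqP. Qed.

Lemma compatible_root a b sigma i j :
  compatible a b sigma -> sigma i j = sigma (root_of (a j) i) j.
Proof.
move=> comp; elim/ord_lt_ind: i => i IHi.
case ki: (kappa (a j) i) => [k|].
  by rewrite (compatible_fits comp ki) (root_of_kappa ki) IHi ?(kappa_lt ki).
by rewrite root_of_id // -kappa_root ki.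
Qed.

(** With [s] the symbol in row [l] of column [j], all rows of the component carry [s] in that
    column, so [b s] copies [a j] there ([fwd]); [bwd] shows that no further row joins in [b s]. *)
Lemma compatible_component a b sigma l j :
  compatible a b sigma -> component l (b (sigma l j)) = component l (a j).
Proof.
move=> comp; have val_l := compatible_value l j comp.
have eq_root : root_at (b (sigma l j)) l = root_at (a j) l.
  by rewrite /root_at val_l.
have [a_root | a_nroot] := boolP (root_at (a j) l); last first.
  by rewrite /component eq_root (negPf a_nroot).
rewrite !component_mem ?eq_root //; set s := sigma l j.
have b_root : root_at (b s) l by rewrite eq_root.
have fwd i : root_of (a j) i = l -> root_of (b s) i = l.
  elim/ord_lt_ind: i => i IHi ri.
  have ki : kappa (b s) i = kappa (a j) i.
    by apply: kappa_eq; rewrite /s -ri -(compatible_root _ _ comp)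
      (compatible_value _ _ comp).
  case kai: (kappa (a j) i) => [k|].
    rewrite (@root_of_kappa _ _ _ k) ?ki // IHi ?(kappa_lt kai) //.
    by rewrite -(root_of_kappa kai).
  by rewrite -ri root_of_id ?root_of_id // -kappa_root ?ki kai.
have bwd i : root_of (b s) i = l -> sigma i j = s /\ root_of (a j) i = l.
  elim/ord_lt_ind: i => i IHi ri.
  case kbi: (kappa (b s) i) => [k|]; last first.
    have -> : i = l by rewrite -ri root_of_id // -kappa_root kbi.
    by rewrite root_of_id.
  have [|sk rk] := IHi k (kappa_lt kbi); first by rewrite -(root_of_kappa kbi).
  (* In column [j'], where [s] stands in row [i], row [i] is linked to row [k], so [s] also stands
     in row [k]. It stands there in column [j] too, hence [j' = j]. *)
  pose j' := (sigma i)^-1%g s; have sj' : sigma i j' = s by rewrite permKV.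
  have kaj' : kappa (a j') i = Some k.
    by rewrite -kbi; apply: kappa_eq; rewrite -(compatible_value i j' comp) sj'.
  have eq_j : j' = j.
    by apply: (@perm_inj _ (sigma k)); rewrite -(compatible_fits comp kaj') sj' sk.
  by rewrite eq_j in sj' kaj'; rewrite (root_of_kappa kaj').
congr Some; apply/setP => -[i v]; rewrite !inE /=.
have val_i : root_of (a j) i = l -> b s i = a j i.
  by move=> ri; rewrite -(compatible_value i j comp) (compatible_root i j comp) ri.
apply/andP/andP => -[/eqP ri /eqP vi].
  by have [_ ri'] := bwd i ri; rewrite ri' eqxx vi val_i.
by rewrite (fwd i ri) eqxx vi val_i.
Qed.

(* A compatible sigma is determined by the rows of the roots, where it matches
   the columns to the symbols with the same component; any such matching
   extends to a compatible sigma, constant along the components. *)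
Lemma card_compatible_matchings a b :
  let X := {x : 'I_m * 'I_n | root_at (a x.2) x.1} in
  #|[set sigma | compatible a b sigma]|
    = #|[set t : {ffun X -> 'I_m * 'I_n} | injectiveb t &
          [forall x, ((t x).1, component (t x).1 (b (t x).2))
             == ((val x).1, component (val x).1 (a (val x).2))]]|.
Proof.
move=> X; set B := RHS.
pose phi sigma : {ffun X -> 'I_m * 'I_n} :=
  [ffun x => ((val x).1, sigma (val x).1 (val x).2)].
pose x i j : X := exist _ (root_of (a j) i, j) (root_of_root (a j) i).
rewrite /B -(card_in_imset (f := phi)); last first.
  move=> sigma sigma'; rewrite !inE => comp comp' eq_phi.
  apply/ffunP => i; apply/permP => j.
  rewrite (compatible_root i j comp) (compatible_root i j comp').
  by have := congr1 (fun t : {ffun X -> _} => (t (x i j)).2) eq_phi; rewrite !ffunE.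
apply: eq_card => t; rewrite [in RHS]inE.
apply/imsetP/andP => [[sigma] | [t_inj t_match]].
  rewrite inE => comp ->; split.
    apply/injectiveP => -[[l j] lj] [[l' j'] lj']; rewrite !ffunE /= => -[el].
    move: lj'; rewrite -el => lj' /perm_inj ej; apply: val_inj.
    by rewrite /= ej.
  by apply/forallP => y; rewrite !ffunE /= (compatible_component _ _ comp).
pose s i j := (t (x i j)).2.
have tx i j : t (x i j) = (root_of (a j) i, s i j)
    /\ component (root_of (a j) i) (a j) = component (root_of (a j) i) (b (s i j)).
  have /eqP[e1 e2] := forallP t_match (x i j).
  by split; [rewrite -e1 /s; case: (t _) | rewrite -e2 /s e1].
have s_agree i j : root_of (b (s i j)) i = root_of (a j) i /\ b (s i j) i = a j i.
  by have [_ /component_agree] := tx i j; apply.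
(* The root of [i] can be read off the symbol through [b], so equal symbols have equal roots and
   injectivity of [t] applies. *)
have s_inj i : injective (s i).
  move=> j j' eq_s; have [r_j _] := s_agree i j; have [r_j' _] := s_agree i j'.
  have eq_r : root_of (a j) i = root_of (a j') i by rewrite -r_j -r_j' eq_s.
  have /(injectiveP _ t_inj)/(congr1 val)[_ //] : t (x i j) = t (x i j').
  by rewrite (tx i j).1 (tx i j').1 eq_s eq_r.
exists [ffun i => perm (s_inj i)].
  rewrite inE; apply/andP; split; apply/forallP => j; apply/forallP => i.
    rewrite /fits_at; case ki: (kappa _ _) => [k|] //; rewrite !ffunE !permE /s.
    suff -> : x i j = x k j by [].
    by apply: val_inj; rewrite /= (root_of_kappa ki).
  by rewrite !ffunE permE (s_agree i j).2.
apply/ffunP => -[[l j] lj]; rewrite !ffunE permE /=.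
have -> : exist _ (l, j) lj = x l j by apply: val_inj; rewrite /= root_of_id.
by rewrite (tx l j).1 root_of_id.
Qed.

End Compatible.

(** * Number of compatible tuples of permutations *)

Section CountCompatible.
Variables m n : nat.
Implicit Types (a b : {ffun 'I_n -> A m}).

Lemma q_counts a l Z :
  q (fun x => counts a x) l Z = #|[pred j | component l (a j) == Some Z]|.
Proof.
rewrite /q (sum_counts a (fun x => component l x == Some Z)).
by rewrite -sum1_card [RHS]big_mkcond.
Qed.

Lemma q_notin_components (r : A m -> nat) l Z : Z \notin components l -> q r l Z = 0%N.
Proof.
rewrite inE => /existsPn no_a; rewrite /q big_pred0 // => x.
exact/negbTE/no_a.
Qed.

(** Matchings are counted with pairs (row, component) as colours. Colour [None] has no column in
    [X], and a set that is no component has neither columns nor symbols, so both give the factor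
    1. *)
Lemma card_compatible_ffact a b :
  #|[set sigma | compatible a b sigma]|
    = (\prod_(l < m) \prod_(Z in components l)
         q (fun x => counts b x) l Z ^_ q (fun x => counts a x) l Z)%N.
Proof.
rewrite card_compatible_matchings.
pose X := {x : 'I_m * 'I_n | root_at (a x.2) x.1}.
pose f (x : X) := ((val x).1, component (val x).1 (a (val x).2)).
pose g (y : 'I_m * 'I_n) := (y.1, component y.1 (b y.2)).
rewrite (card_matchings f g) /=.
rewrite -(pair_bigA _ (fun l oZ => #|[pred y | g y == (l, oZ)]|
                                   ^_ #|[pred x | f x == (l, oZ)]|)%N) /=.
apply: eq_bigr => l _; rewrite (bigD1 None) //=.
have -> : #|[pred x | f x == (l, None)]| = 0%N; last rewrite ffactn0 mul1n.
  apply: eq_card0 => -[[k j] kj]; rewrite !inE /f /=; apply/eqP => -[ek].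
  by move: kj; rewrite -isSome_component /= => /[swap] ->.
rewrite (reindex_omap Some id) => [|[Z|] //]; rewrite [RHS]big_mkcond /=.
apply: eq_big => [Z | Z _]; first by rewrite eqxx.
have pair_inj : injective (pair l : 'I_n -> 'I_m * 'I_n) by move=> j k [].
have -> : #|[pred x | f x == (l, Some Z)]| = q (fun x => counts a x) l Z.
  rewrite q_counts -(card_image val_inj) -(card_image pair_inj).
  apply: eq_card => y; apply/imageP/imageP => [[[[k j] /= kj]]|[j]].
    by rewrite inE /f /= => /eqP[-> cj] ->; exists j; rewrite ?inE ?cj.
  rewrite inE => /eqP cj ->.
  have lj : root_at (a (l, j).2) (l, j).1 by rewrite -isSome_component cj.
  by exists (exist _ (l, j) lj); rewrite ?inE /f /= ?cj.
have -> : #|[pred y | g y == (l, Some Z)]| = q (fun x => counts b x) l Z.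
  rewrite q_counts -(card_image pair_inj).
  apply: eq_card => y; apply/idP/imageP => [|[j]].
    by case: y => k j; rewrite inE /g /= => /eqP[-> cj]; exists j; rewrite ?inE ?cj.
  by rewrite !inE => /eqP cj ->; rewrite /g /= cj.
by case: ifPn => // Zl; rewrite !(q_notin_components _ Zl).
Qed.

(** A compatible [sigma] forces the constraint on C, since row [l] carries the columns with
    component [Z] onto the symbols with component [Z]; under it the falling factorials are
    factorials. *)
Lemma card_compatible a b :
  #|[set sigma | compatible a b sigma]|
    = (admC (fun x => counts a x) (fun x => counts b x)
       * \prod_(l < m) \prod_(Z in components l) (q (fun x => counts a x) l Z)`!)%N.
Proof.
have [adm | nadm] := boolP (admC _ _).
  rewrite mul1n card_compatible_ffact; apply: eq_bigr => l _; apply: eq_bigr => Z Zl.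
  by have /forallP/(_ l)/forall_inP/(_ Z Zl)/eqP -> := adm; rewrite ffactnn.
rewrite mul0n; apply: eq_card0 => sigma; rewrite inE.
apply: contraNF nadm => comp; apply/forallP => l; apply/forall_inP => Z _.
rewrite !q_counts -!sum1_card (reindex (sigma l)) /=; last first.
  exact/onW_bij/(injF_bij perm_inj).
by apply/eqP; apply: eq_bigl => j; rewrite !inE (compatible_component _ _ comp).
Qed.

(** Each fitting [sigma] is compatible with exactly one [b], obtained by pulling the values of [a]
    back along each row. *)
Lemma card_fits a :
  #|[set sigma : {ffun 'I_m -> 'S_n} | [forall j, fits (a j) (fun i => sigma i j)]]|
    = (\sum_b #|[set sigma | compatible a b sigma]|)%N.
Proof.
pose B (sigma : {ffun 'I_m -> 'S_n}) : {ffun 'I_n -> A m} :=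
  [ffun s => [ffun i => a ((sigma i)^-1%g s) i]].
rewrite -sum1dep_card (partition_big B xpredT) //=; apply: eq_bigr => b _.
rewrite -sum1dep_card; apply: eq_bigl => sigma; rewrite /compatible; congr (_ && _).
apply/eqP/forallP => [<- j | val_b].
  by apply/forallP => i; rewrite !ffunE permK.
apply/ffunP => s; apply/ffunP => i; rewrite !ffunE.
by have /forallP/(_ i)/eqP <- := val_b ((sigma i)^-1%g s); rewrite permKV.
Qed.

End CountCompatible.

(** * Latin rectangles *)

Definition column_distinct m n (sigma : {ffun 'I_m -> 'S_n}) : bool :=
  [forall j, injectiveb (fun i => sigma i j)].

Lemma K_perm m n :
  K m.+1 n = #|[set sigma : {ffun 'I_m.+1 -> 'S_n} |
                 column_distinct sigma & sigma ord0 == 1%g]|.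
Proof.
pose phi (sigma : {ffun 'I_m.+1 -> 'S_n}) : 'M['I_n]_(m.+1, n) :=
  \matrix_(i, j) sigma i j.
rewrite -(card_in_imset (f := phi)) /K; last first.
  move=> s s' _ _ /matrixP eq_ss'; apply/ffunP => i; apply/permP => j.
  by have := eq_ss' i j; rewrite !mxE.
apply: eq_card => L; rewrite inE; apply/and3P/imsetP => [[rowL colL L0] | [s]].
  pose row_inj i := injectiveP _ (forallP rowL i).
  exists [ffun i => perm (row_inj i)]; last first.
    by apply/matrixP => i j; rewrite mxE ffunE permE.
  rewrite inE; apply/andP; split.
    apply/forallP => j; apply/injectiveP => i i'; rewrite !ffunE !permE.
    exact: injectiveP _ (forallP colL j) i i'.
  rewrite ffunE; apply/eqP/permP => j; rewrite permE perm1.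
  by have /forallP/(_ ord0)/forallP/(_ j)/eqP := L0.
rewrite inE => /andP[s_col /eqP s0] ->; split; apply/forallP => i.
- by apply/injectiveP => j j'; rewrite !mxE => /perm_inj.
- apply/injectiveP => j j'; rewrite !mxE.
  exact: injectiveP _ (forallP s_col i) j j'.
- apply/forallP => j; apply/implyP => i0; rewrite mxE.
  have -> : i = ord0 by apply: val_inj; apply/eqP.
  by rewrite s0 perm1.
Qed.

(* Permuting the columns puts any prescribed permutation in the first row. *)
Lemma card_column_distinct m n :
  #|[set sigma : {ffun 'I_m.+1 -> 'S_n} | column_distinct sigma]| = (n`! * K m.+1 n)%N.
Proof.
rewrite -sum1dep_card.
rewrite (partition_big (fun s : {ffun 'I_m.+1 -> 'S_n} => s ord0) xpredT) //=.
rewrite (eq_bigr (fun=> K m.+1 n)) => [|t _].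
  by rewrite sum_nat_const card_Sn.
rewrite K_perm -sum1dep_card.
(* As [(t * s) j = s (t j)], left multiplication permutes the columns. *)
pose mul (t : 'S_n) (s : {ffun 'I_m.+1 -> 'S_n}) := [ffun i => (t * s i)%g].
rewrite (reindex (mul t)) /=; last first.
  exists (mul t^-1%g) => s _; apply/ffunP => i; rewrite !ffunE.
    by rewrite mulKg.
  by rewrite mulKVg.
apply: eq_bigl => s; rewrite ffunE.
have -> : ((t * s ord0)%g == t) = (s ord0 == 1%g).
  by rewrite -{2}[t]mulg1 (inj_eq (mulgI t)).
congr (_ && _); apply/forallP/forallP => s_col j; apply/injectiveP => i i' e.
  apply: (injectiveP _ (s_col (t^-1%g j))).
  by rewrite !ffunE !permM permKV.
by apply: (injectiveP _ (s_col (t j))); move: e; rewrite !ffunE !permM.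
Qed.

Lemma sum_q_components m (r : A m -> nat) l :
  (\sum_(Z in components l) q r l Z = \sum_(a | root_at a l) r a)%N.
Proof.
rewrite [RHS](partition_big (fun a => odflt set0 (component l a))
                            (mem (components l))) /=; last first.
  move=> a a_root; rewrite inE; apply/existsP; exists a.
  by move: a_root; rewrite -isSome_component; case: (component l a).
apply: eq_bigr => Z _; apply: eq_bigl => a; rewrite -isSome_component.
by case: (component l a).
Qed.

(** The first position is always a root, so its components partition [A m.+1] and the constraint
    there fixes the total. *)
Lemma admC_sum m (r c : A m.+1 -> nat) :
  admC r c -> (\sum_a c a = \sum_a r a)%N.
Proof.
move=> /forallP/(_ ord0)/forall_inP adm.
have root0 (a : A m.+1) : root_at a ord0 by rewrite /root_at; case: (a ord0) => -[].
have sum_root0 (f : A m.+1 -> nat) : (\sum_a f a = \sum_(a | root_at a ord0) f a)%N.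
  by apply: eq_bigl => a; rewrite root0.
rewrite !sum_root0 -!sum_q_components; apply: eq_bigr => Z /adm /eqP //.
Qed.

(** * The factorial formula *)

Section LatinRectangles.
Variables m n : nat.
Let cnt (a : {ffun 'I_n -> A m.+1}) : A m.+1 -> nat := fun x => counts a x.
Let Q (r : families m.+1 n) : nat :=
  (\prod_(l < m.+1) \prod_(Z in components l) (q (fun a => r a) l Z)`!)%N.

(** Each column is expanded separately; the choices form a word [a], and the exponents
    [m.+1 + odd (zeta (a j))] add up over the [n] columns. *)
Lemma prod_injectiveb_expand (sigma : {ffun 'I_m.+1 -> 'S_n}) :
  (column_distinct sigma)%:R
    = \sum_(a : {ffun 'I_n -> A m.+1})
        (-1) ^+ (n * m.+1 + sumW (cnt a))
        * [forall j, fits (a j) (fun i => sigma i j)]%:R :> rat.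
Proof.
rewrite -prod_nat_of_bool.
under eq_bigr do rewrite injectiveb_expand.
rewrite bigA_distr_bigA; apply: eq_bigr => a _.
rewrite big_split /= prod_nat_of_bool prodrXr; congr ((-1) ^+ _ * _).
by rewrite big_split sum_nat_const card_ord /sumW (sum_counts a (odd \o @zeta m.+1)).
Qed.

Lemma fact_K_expand :
  (n`! * K m.+1 n)%:R
    = \sum_(a : {ffun 'I_n -> A m.+1}) \sum_(b : {ffun 'I_n -> A m.+1})
        (-1) ^+ (n * m.+1 + sumW (cnt a))
        * (admC (cnt a) (cnt b) * Q (counts a))%:R :> rat.
Proof.
rewrite -card_column_distinct -sum1dep_card big_mkcond natr_sum.
transitivity (\sum_(s : {ffun 'I_m.+1 -> 'S_n}) (column_distinct s)%:R : rat).
  by apply: eq_bigr => s _; case: column_distinct.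
under eq_bigr do rewrite prod_injectiveb_expand.
rewrite exchange_big; apply: eq_bigr => a _ /=.
rewrite -!mulr_sumr; congr (_ * _); rewrite -!natr_sum; congr _%:R.
transitivity (\sum_(b : {ffun 'I_n -> A m.+1}) #|[set s | compatible a b s]|)%N; last first.
  by apply: eq_bigr => b _; rewrite card_compatible.
rewrite -card_fits -sum1dep_card [RHS]big_mkcond; apply: eq_bigr => s _.
by case: [forall j, _].
Qed.

Lemma natr_fact_neq0 k : (k`!)%:R != 0 :> rat.
Proof. by rewrite Num.Theory.pnatr_eq0 -lt0n fact_gt0. Qed.

Lemma card_counts_rat (T : finType) (r : {ffun T -> 'I_n.+1}) :
  (\sum_x r x = n)%N ->
  #|[set a | counts a == r]|%:R = n`!%:R / (\prod_x (r x)`!)%:R :> rat.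
Proof.
move=> sum_r; rewrite -(card_counts sum_r) natrM mulfK // natr_prod.
by apply/prodf_neq0 => x _; apply: natr_fact_neq0.
Qed.

(** Grouping the words [a] and [b] by multiplicities brings in [n!] twice: one cancels against the
    left side, the other is the factor for l = 0. *)
Lemma K_factorial_sum : (K m.+1 n)%:R = factorial_sum m.+1 n.
Proof.
apply: (mulfI (natr_fact_neq0 n)); rewrite -natrM fact_K_expand.
rewrite (sum_over_counts (fun r : families m.+1 n =>
  \sum_(b : {ffun 'I_n -> A m.+1}) (-1) ^+ (n * m.+1 + sumW (fun a => r a))
        * (admC (fun a => r a) (cnt b) * Q r)%:R : rat)).
rewrite /factorial_sum mulr_sumr; apply: eq_bigr => r /eqP sum_r.
rewrite (sum_over_counts (fun c : families m.+1 n =>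
  (-1) ^+ (n * m.+1 + sumW (fun a => r a))
     * (admC (fun a => r a) (fun b => c b) * Q r)%:R : rat)).
rewrite !mulr_sumr big_mkcond [RHS]big_mkcond; apply: eq_bigr => c _ /=.
have [adm | _] := boolP (admC _ _); last by rewrite mul0n !mulr0; case: ifP.
have sum_c := etrans (admC_sum adm) sum_r.
rewrite sum_c eqxx mul1n !card_counts_rat // /denom !natrM invfM.
rewrite -/(Q r).
move: ((-1) ^+ _) (Q r)%:R n`!%:R (_%:R^-1) (_%:R^-1) => s x y z w.
ring.
Qed.

End LatinRectangles.

(** * Signs and rising factorials *)

Lemma rising_opp k : rising (- k%:R) k = (-1) ^+ k * k`!%:R :> rat.
Proof.
rewrite /rising (reindex_inj rev_ord_inj) /= fact_prod big_add1 big_mkord.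
rewrite natr_prod; transitivity (\prod_(i < k) - (i.+1%:R : rat)).
  by apply: eq_bigr => i _; rewrite natrB ?ltn_ord // addKr.
by rewrite prodrN card_ord.
Qed.

(** Each [a] has one component per root, so [r a] is counted [zeta a] times and only odd [zeta a]
    affect the sign. *)
Lemma sum_q_parity m (r : A m -> nat) :
  (-1) ^+ (\sum_(l < m) \sum_(Z in components l) q r l Z) = (-1) ^+ sumW r :> rat.
Proof.
under eq_bigr do rewrite sum_q_components big_mkcond.
rewrite exchange_big /= /sumW [in RHS]big_mkcond -!prodrXr /=.
apply: eq_bigr => a _; rewrite -big_mkcond /=.
have -> : (\sum_(l < m | root_at a l) r a = zeta a * r a)%N.
  by rewrite sum_nat_const /zeta cardsE.
by rewrite exprM -signr_odd; case: odd; rewrite ?expr1 ?expr1n.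
Qed.

Lemma factorial_sum_rising m n :
  factorial_sum m.+1 n = (-1) ^+ (n * m) * rising_sum m.+1 n.
Proof.
rewrite /factorial_sum /rising_sum mulr_sumr; apply: eq_bigr => r _.
rewrite mulr_sumr; apply: eq_bigr => c _; rewrite rising_opp.
set Q := (\prod_(l < m.+1) \prod_(Z in components l) _)%N.
have -> : \prod_(l < m.+1) \prod_(Z in components l)
      rising (- (q (fun a => r a) l Z)%:R) (q (fun a => r a) l Z)
    = (-1) ^+ sumW (fun a => r a) * Q%:R :> rat.
  rewrite -sum_q_parity -prodrXr natr_prod -big_split; apply: eq_bigr => l _ /=.
  rewrite -prodrXr natr_prod -big_split; apply: eq_bigr => Z _ /=.
  exact: rising_opp.
(* Of the exponent [n * m.+1 = n + n * m], the first [n] is the sign of the factor for l = 0. *)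
rewrite mulnS addnC !exprD natrM.
move: ((-1) ^+ sumW _) ((-1) ^+ n) ((-1) ^+ (n * m)) n`!%:R Q%:R (_^-1) => s t u x y z.
ring.
Qed.

Theorem theorem5p1 (m n : nat) (m_ge1 : (1 <= m)%N) (m_le_n : (m <= n)%N) :
  (K m n)%:R = factorial_sum m n
  /\ factorial_sum m n = (-1) ^+ (n * (m - 1)) * rising_sum m n.
Proof.
case: m m_ge1 {m_le_n} => // m _; split; first exact: K_factorial_sum.
by rewrite subn1 factorial_sum_rising.
Qed.
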